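(* Let $A$ be a complex $n\times n$ matrix ($n\ge1$) and let $p$ be a monic polynomial with distinct roots $\Lambda=\{\lambda_1,\dots,\lambda_d\}$, $d\geq 1$, such that $B=p(A)$ is similar to a diagonal matrix. For $f\in C_\Lambda(p(\sigma(A)))$, with coset $[f]\in C_\Lambda(p(\sigma(A)))/\mathcal I_{\sigma(A)}$ and $\chi_A(f)=\sum_{j=1}^d\delta_j(A)f_j(B)\in\mathbb M_n$, one has $$\sigma(\chi_A(f))=\sigma([f]),$$ where $\sigma([f])$ is the spectrum of $[f]$ in the quotient algebra $C_\Lambda(p(\sigma(A)))/\mathcal I_{\sigma(A)}$.
   Context: $\mathbb M_n$ is the algebra of complex $n\times n$ matrices, and $\sigma(\cdot)$ of a matrix is its set of eigenvalues. Here $p(z)=(z-\lambda_1)\cdots(z-\lambda_d)$ and $\delta_j(z)=\prod_{k\neq j}\frac{z-\lambda_k}{\lambda_j-\lambda_k}$. For compact nonempty $M\subset\mathbb C$, $C_\Lambda(M)$ is the commutative unital Banach algebra of continuous functions $f:M\to\mathbb C^d$ with unit $\mathbf 1=(1,\dots,1)^t$ and product (polyproduct) given componentwise by $$(f\circledcirc g)_i(w)=f_i(w)g_i(w)-w\sum_{j\neq i}\frac{(f_i(w)-f_j(w))(g_i(w)-g_j(w))}{p'(\lambda_j)(\lambda_i-\lambda_j)},$$ and norm $\|f\|=\sup_{|g|_M\le1}|f\circledcirc g|_M$, where $|f|_M=\max_{w\in M}\max_j|f_j(w)|$. For $f\in C_\Lambda(M)$ put $\hat f(z)=\sum_{j=1}^d\delta_j(z)f_j(p(z))$,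 $z\in p^{-1}(M)$. With $M=p(\sigma(A))$, $\mathcal I_{\sigma(A)}=\{f\in C_\Lambda(M):\hat f(z)=0\text{ for all }z\in\sigma(A)\}$ is a closed ideal, $[f]=f+\mathcal I_{\sigma(A)}$, and the quotient is a unital Banach algebra with norm $\|[f]\|=\inf_{g\in\mathcal I_{\sigma(A)}}\|f+g\|$. For $f_j$ defined on $\sigma(B)=p(\sigma(A))$ the matrix $f_j(B)$ is $Tf_j(D)T^{-1}$, where $B=TDT^{-1}$ with $D$ diagonal and $f_j$ is applied to the diagonal entries of $D$; equivalently $f_j(B)=q(B)$ for any polynomial $q$ agreeing with $f_j$ on $\sigma(B)$. *)

(* Defs.v *)
From HB Require Import structures.
From mathcomp Require Import all_boot all_order all_algebra.
From mathcomp Require Import generic_quotient ring_quotient complex ring.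
From mathcomp Require Import boolp classical_sets functions cardinality reals.
From mathcomp Require Import topology normedtype.

Set Implicit Arguments.
Unset Strict Implicit.
Unset Printing Implicit Defensive.

Import Order.TTheory GRing.Theory Num.Theory.
Import numFieldTopology.Exports numFieldNormedType.Exports.

Local Open Scope classical_set_scope.
Local Open Scope quotient_scope.
Local Open Scope ring_scope.

(** Invertibility is spelled out because [algType] carries no unit predicate. *)
Definition spectrum (C : fieldType) (B : algType C) (a : B) : set C :=
  [set mu | ~ exists b : B, (a - mu%:A) * b = 1 /\ b * (a - mu%:A) = 1].

Section Lagrange.
Variable C : fieldType.

(** The distinct points lambda_1, ..., lambda_d, indexed by ['I_d]. *)
Record nodes (d : nat) := Nodes {
  node :> 'I_d -> C;
  nodes_gt0 : (0 < d)%N;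
  node_inj : injective node }.

Variables (d : nat) (L : nodes d).

Definition nodepoly : {poly C} := \prod_(j < d) ('X - (L j)%:P).

(** The Lagrange polynomial delta_j. *)
Definition lagr (j : 'I_d) : {poly C} :=
  \prod_(k < d | k != j) ((L j - L k)^-1 *: ('X - (L k)%:P)).

(** The polyproduct at the point [w], as a product on [C^d]; it is the product
    of [C[z]/(p(z) - w)] read in the basis of the delta_j, see [interp_mul]. *)
Definition polyprod (w : C) (a b : 'cV[C]_d) : 'cV[C]_d :=
  \col_i (a i 0 * b i 0 - w * \sum_(j < d | j != i)
    (a i 0 - a j 0) * (b i 0 - b j 0) / (nodepoly^`().[L j] * (L i - L j))).

(** [sum_j a_j delta_j]: the polynomial of degree less than [d] taking the value
    [a_j] at the [j]-th node. *)
Definition interp (a : 'cV[C]_d) : {poly C} := \sum_(j < d) a j 0 *: lagr j.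

Lemma node_sub_neq0 i j : i != j -> L i - L j != 0.
Proof. by move=> ij; rewrite subr_eq0 (inj_eq (@node_inj _ L)). Qed.

Lemma lagr_node i j : (lagr j).[L i] = (i == j)%:R.
Proof.
rewrite horner_prod; have [->|ij] := eqVneq i j.
  rewrite big1// => k kj; rewrite hornerZ hornerXsubC mulVf//.
  by rewrite node_sub_neq0// eq_sym.
by rewrite (bigD1 i)//= hornerZ hornerXsubC subrr mulr0 mul0r.
Qed.

Lemma interp_node a i : (interp a).[L i] = a i 0.
Proof.
rewrite horner_sum (bigD1 i)//= hornerZ lagr_node eqxx mulr1 big1 ?addr0// => j ji.
by rewrite hornerZ lagr_node eq_sym (negbTE ji) mulr0.
Qed.

Lemma size_nodepoly : size nodepoly = d.+1.
Proof. by rewrite /nodepoly -big_enum size_prod_XsubC size_enum_ord. Qed.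

Lemma nodepoly_neq0 : nodepoly != 0.
Proof. by rewrite -size_poly_gt0 size_nodepoly. Qed.

Lemma nodepoly_node i : nodepoly.[L i] = 0.
Proof. by rewrite horner_prod (bigD1 i)//= hornerXsubC subrr mul0r. Qed.

Lemma nodepoly_dvd (q : {poly C}) :
  (forall i, q.[L i] = 0) -> nodepoly %| q.
Proof.
move=> q0; have -> : nodepoly = \prod_(z <- codom L) ('X - z%:P).
  by rewrite codomE big_map big_enum.
apply: uniq_roots_dvdp.
  by apply/allP => z /codomP[i ->]; rewrite /root q0.
by rewrite uniq_rootsE map_inj_uniq ?enum_uniq//; exact: node_inj.
Qed.

Lemma nodepoly_derivE j : nodepoly^`().[L j] = \prod_(k < d | k != j) (L j - L k).
Proof.
rewrite /nodepoly (bigD1 j)//= derivM derivXsubC mul1r !hornerE subrr mul0r addr0.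
by rewrite horner_prod; apply: eq_bigr => k _; rewrite hornerXsubC.
Qed.

Lemma nodepoly_deriv_neq0 j : nodepoly^`().[L j] != 0.
Proof.
rewrite nodepoly_derivE; apply/prodf_neq0 => k kj.
by rewrite node_sub_neq0// eq_sym.
Qed.

Lemma lagr_mul j : nodepoly^`().[L j] *: (('X - (L j)%:P) * lagr j) = nodepoly.
Proof.
rewrite /nodepoly [RHS](bigD1 j)//= /lagr scaler_prod.
rewrite -scalerAr scalerA nodepoly_derivE -big_split/= big1 ?scale1r// => k kj.
by rewrite mulfV// node_sub_neq0// eq_sym.
Qed.

Lemma size_lagr j : size (lagr j) = d.
Proof.
have lj0 : lagr j != 0.
  apply: contraTneq nodepoly_neq0 => lj0.
  by rewrite -(lagr_mul j) lj0 mulr0 scaler0 eqxx.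
have := size_nodepoly; rewrite -(lagr_mul j) size_scale ?nodepoly_deriv_neq0//.
by rewrite size_mul ?polyXsubC_eq0// size_XsubC => -[].
Qed.

Lemma size_interp a : (size (interp a) <= d)%N.
Proof.
apply: (leq_trans (size_sum _ _ _)); apply/bigmax_leqP => j _.
by rewrite (leq_trans (size_scale_leq _ _))// size_lagr.
Qed.

Lemma poly_nodes_eq0 (q : {poly C}) : (size q <= d)%N ->
  (forall i, q.[L i] = 0) -> q = 0.
Proof.
move=> sq /nodepoly_dvd/modp_eq0; rewrite modp_small// size_nodepoly.
exact: leq_ltn_trans sq _.
Qed.

Lemma interp_eq (q : {poly C}) : (size q <= d)%N ->
  q = interp (\col_i q.[L i]).
Proof.
move=> sq; apply/eqP; rewrite -subr_eq0; apply/eqP/poly_nodes_eq0.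
  by rewrite (leq_trans (size_polyD _ _))// geq_max sq size_polyN size_interp.
by move=> i; rewrite !hornerE interp_node mxE subrr.
Qed.

Lemma interpD a b : interp (a + b) = interp a + interp b.
Proof. by rewrite -big_split; apply: eq_bigr => j _; rewrite mxE scalerDl. Qed.

Lemma interpZ c a : interp (c *: a) = c *: interp a.
Proof. by rewrite scaler_sumr; apply: eq_bigr => j _; rewrite mxE scalerA. Qed.

Lemma interp1 : interp (const_mx 1) = 1.
Proof.
apply/esym; rewrite [LHS]interp_eq; last by rewrite size_poly1 (nodes_gt0 L).
by congr interp; apply/colP => i; rewrite !mxE hornerE.
Qed.

Lemma lagr_deriv i j : i != j -> (lagr j)^`().[L i] =
  nodepoly^`().[L i] / (nodepoly^`().[L j] * (L i - L j)).
Proof.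
move=> ij; rewrite -[in X in X / _](lagr_mul j) derivZ derivM derivXsubC !hornerE.
rewrite lagr_node (negbTE ij) add0r.
by field; rewrite nodepoly_deriv_neq0 node_sub_neq0.
Qed.

Lemma interp_deriv a i : (interp a)^`().[L i] =
  \sum_(j < d | j != i) (a j 0 - a i 0) *
     (nodepoly^`().[L i] / (nodepoly^`().[L j] * (L i - L j))).
Proof.
have -> : (interp a)^`() = (interp (a - a i 0 *: const_mx 1))^`().
  rewrite interpD -scaleN1r !interpZ interp1 derivD !derivZ derivC.
  by rewrite !scaler0 addr0.
rewrite raddf_sum horner_sum (bigD1 i)//= derivZ hornerZ !mxE mulr1 subrr.
rewrite mul0r add0r; apply: eq_bigr => j ji.
by rewrite derivZ hornerZ !mxE mulr1 lagr_deriv// eq_sym.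
Qed.

Lemma interp_mul a b : exists Q : {poly C}, forall w,
  interp a * interp b = interp (polyprod w a b) + Q * (nodepoly - w%:P).
Proof.
pose ab : 'cV[C]_d := \col_i (a i 0 * b i 0).
have /dvdpP[Q QE] : nodepoly %| interp a * interp b - interp ab.
  by apply: nodepoly_dvd => i; rewrite !hornerE !interp_node mxE subrr.
have sQ : (size Q <= d)%N.
  have [->|Q0] := eqVneq Q 0; first by rewrite size_poly0.
  have : (size (Q * nodepoly)%R <= d.-1 + d)%N.
    rewrite -QE (leq_trans (size_polyD _ _))// geq_max size_polyN.
    rewrite (leq_trans (size_interp _)) ?leq_addl// andbT.
    rewrite (leq_trans (size_polyMleq _ _))//.
    rewrite -subn1 leq_subLR addnA add1n prednK ?(nodes_gt0 L)//.
    by rewrite leq_add ?size_interp.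
  rewrite size_mul ?nodepoly_neq0// size_nodepoly addnS /= leq_add2r.
  by move=> h; rewrite (leq_trans h)// leq_pred.
exists Q => w; have -> : polyprod w a b = ab + w *: \col_i Q.[L i].
  apply/colP => i; rewrite !mxE; congr (_ + _); rewrite -mulrN; congr (_ * _).
  apply: (mulfI (nodepoly_deriv_neq0 i)).
  have := congr1 (fun q => q^`().[L i]) QE.
  rewrite /= derivB !derivM !hornerE nodepoly_node mulr0 add0r.
  rewrite !interp_deriv !interp_node [RHS]mulrC => <-.
  rewrite mulrN mulr_sumr mulr_suml mulr_sumr -!sumrN -!big_split/=.
  by apply: eq_bigr => j ji; rewrite !mxE; ring.
rewrite interpD interpZ -interp_eq// -mul_polyC mulrBr -QE; ring.
Qed.


Lemma interp_modI w a b (Q : {poly C}) :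
  interp a = interp b + Q * (nodepoly - w%:P) -> a = b.
Proof.
move=> ab; have sP : size (nodepoly - w%:P) = d.+1.
  rewrite size_polyDl size_nodepoly// size_polyN.
  by rewrite (leq_ltn_trans (size_polyC_leq1 _))// ltnS (nodes_gt0 L).
have : interp (a - b) = Q * (nodepoly - w%:P).
  by rewrite interpD -scaleN1r interpZ scaleN1r ab addrC addKr.
have [->|Q0] := eqVneq Q 0.
  rewrite mul0r => ab0; apply/subr0_eq/colP => i.
  by rewrite -interp_node ab0 hornerC mxE.
move=> /(congr1 (fun q : {poly C} => size q)) sab.
have := size_interp (a - b); rewrite sab size_mul//; last first.
  by rewrite -size_poly_gt0 sP.
rewrite sP addnS/= -[leqRHS]add0n leq_add2r leqn0 size_poly_eq0.
by rewrite (negbTE Q0).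
Qed.

Lemma polyprodC w a b : polyprod w a b = polyprod w b a.
Proof.
apply/colP => i; rewrite !mxE mulrC; congr (_ - _ * _).
by apply: eq_bigr => j _; rewrite [X in X / _]mulrC.
Qed.

Lemma polyprodA w a b c :
  polyprod w a (polyprod w b c) = polyprod w (polyprod w a b) c.
Proof.
have [Q1 /(_ w) E1] := interp_mul b c; have [Q2 /(_ w) E2] := interp_mul a b.
have [Q3 /(_ w) E3] := interp_mul a (polyprod w b c).
have [Q4 /(_ w) E4] := interp_mul (polyprod w a b) c.
apply: (@interp_modI w _ _ (Q4 + Q2 * interp c - Q3 - Q1 * interp a)).
move: E1 => /esym/(canRL (addrK _)) E1; move: E2 => /esym/(canRL (addrK _)) E2.
move: E3 => /esym/(canRL (addrK _)) ->; move: E4 => /esym/(canRL (addrK _)) ->.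
by rewrite E1 E2; ring.
Qed.

Lemma polyprod1 w a : polyprod w (const_mx 1) a = a.
Proof.
apply/colP => i; rewrite !mxE mul1r big1 ?mulr0 ?subr0// => j _.
by rewrite !mxE subrr !mul0r.
Qed.

Lemma polyprodDl w a b c :
  polyprod w (a + b) c = polyprod w a c + polyprod w b c.
Proof.
apply/colP => i; rewrite !mxE addrACA -opprD -mulrDr -big_split mulrDl /=.
congr (_ - _ * _); apply: eq_bigr => j _; rewrite !mxE -mulrDl.
by congr (_ / _); ring.
Qed.

Lemma polyprodZl w k a b : polyprod w (k *: a) b = k *: polyprod w a b.
Proof.
apply/colP => i; rewrite !mxE mulrBr (mulrCA k w)
  [k * \sum_(_ < _ | _) _]mulr_sumr mulrA.
congr (_ - _ * _); apply: eq_bigr => j _.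
by rewrite !mxE -mulrBr -!mulrA.
Qed.

End Lagrange.

Record cset (C : numClosedFieldType) := CSet {
  cset_set :> set C;
  cset_compact : compact cset_set;
  cset_neq0 : cset_set !=set0 }.

Lemma horner_cts (C : numClosedFieldType) (q : {poly C}) :
  continuous (fun z => q.[z]).
Proof.
elim/poly_ind: q => [|q c ih] z.
  by under eq_fun do rewrite horner0; exact: cst_continuous.
under eq_fun do rewrite hornerMXaddC.
apply: (@continuousD C C C (fun x => q.[x] * x) (fun=> c)).
  by apply: (@continuousM C C (fun x => q.[x]) id); [exact: ih|exact: cvg_id].
exact: cst_continuous.
Qed.

Section PolyImage.
Variables (C : numClosedFieldType) (q : {poly C}) (K : cset C).

Let polyimage_compact : compact ((fun z => q.[z]) @` K).
Proof.
apply: continuous_compact; last exact: cset_compact.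
exact/continuous_subspaceT/horner_cts.
Qed.

Let polyimage_neq0 : (fun z => q.[z]) @` K !=set0.
Proof. by have [z Kz] := cset_neq0 K; exists q.[z]; exists z. Qed.

Definition polyimage : cset C := CSet polyimage_compact polyimage_neq0.
End PolyImage.

Section MxSpec.
Variables (C : numClosedFieldType) (n : nat) (A : 'M[C]_n.+1).

Let mxspec_finite : finite_set [set a | eigenvalue A a].
Proof.
have [r rE] := closed_field_poly_normal (char_poly A).
apply: (@sub_finite_set _ _ [set` r]); last exact: finite_seq.
move=> a /=; rewrite eigenvalue_root_char rE rootZ ?root_prod_XsubC//.
by rewrite lead_coef_eq0 monic_neq0// char_poly_monic.
Qed.

Let mxspec_neq0 : [set a | eigenvalue A a] !=set0.
Proof.
have /closed_rootP[a ra] : size (char_poly A) != 1%N by rewrite size_char_poly.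
by exists a; rewrite /= eigenvalue_root_char.
Qed.

Definition mxspec : cset C := CSet (finite_compact mxspec_finite) mxspec_neq0.
End MxSpec.

Lemma cV_continuousP (T : topologicalType) (C : numFieldType) m
    (f : T -> 'cV[C]_m) :
  (forall i, continuous (fun t => f t i 0)) -> continuous f.
Proof.
move=> cf t U [P fP PU]; apply: (@filterS _ (nbhs t) _
    [set s | forall i, P i 0 (f s i 0)]).
  by move=> s Ps; apply: PU => i j; rewrite (ord1 j).
by apply: filter_forall => i; exact: (cf i t _ (fP i 0)).
Qed.

(** C_Lambda(M): the continuous functions [M -> C^d], with the polyproduct. *)
Definition polyalg (C : numClosedFieldType) d (L : nodes C d) (M : cset C) :=
  continuousType M 'cV[C]_d.

HB.instance Definition _ C d L M := Choice.on (@polyalg C d L M).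

Section PolyAlg.
Variables (C : numClosedFieldType) (d : nat) (L : nodes C d) (M : cset C).
Local Notation T := (polyalg L M).
Implicit Types f g h : T.

Definition pa_val f : M -> 'cV[C]_d := f.

Lemma pa_ext f g : pa_val f =1 pa_val g -> f = g.
Proof. by move=> fg; apply/continuousEP. Qed.

Lemma pa_coord_cts f i : continuous (fun w => pa_val f w i 0).
Proof.
move=> w; apply: (@continuous_comp _ _ _ (pa_val f) (fun v : 'cV[C]_d => v i 0)).
  exact: (@cts_fun _ _ f).
exact: coord_continuous.
Qed.

Definition pa_mk (u : M -> 'cV[C]_d)
    (cu : forall i, continuous (fun w => u w i 0)) : T :=
  mkcts (cV_continuousP cu).

Lemma pa_mkE u cu w : pa_val (@pa_mk u cu) w = u w.
Proof. by []. Qed.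

Fact pa_cst_subproof (v : 'cV[C]_d) (i : 'I_d) :
  continuous (fun _ : M => v i 0).
Proof. by move=> w; exact: cst_continuous. Qed.
Definition pa_cst v : T := pa_mk (@pa_cst_subproof v).

Fact pa_opp_subproof f i : continuous (fun w => (- pa_val f w) i 0).
Proof.
move=> w; under eq_fun do rewrite mxE.
exact/continuousN/pa_coord_cts.
Qed.
Definition pa_opp f : T := pa_mk (@pa_opp_subproof f).

Fact pa_add_subproof f g i : continuous (fun w => (pa_val f w + pa_val g w) i 0).
Proof.
move=> w; under eq_fun do rewrite mxE.
exact: continuousD (@pa_coord_cts f i w) (@pa_coord_cts g i w).
Qed.
Definition pa_add f g : T := pa_mk (@pa_add_subproof f g).

Fact pa_scale_subproof (c : C) f i : continuous (fun w => (c *: pa_val f w) i 0).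
Proof.
move=> w; under eq_fun do rewrite mxE.
exact: continuousM (@cst_continuous _ _ c w) (@pa_coord_cts f i w).
Qed.
Definition pa_scale c f : T := pa_mk (@pa_scale_subproof c f).

Fact pa_mul_subproof f g i :
  continuous (fun w => polyprod L (set_val w) (pa_val f w) (pa_val g w) i 0).
Proof.
have cfg h k l : continuous (fun w => pa_val h w k 0 - pa_val h w l 0).
  by move=> w; exact: continuousB (@pa_coord_cts h k w) (@pa_coord_cts h l w).
have cS : continuous (fun w => \sum_(j < d | j != i)
    (pa_val f w i 0 - pa_val f w j 0) * (pa_val g w i 0 - pa_val g w j 0) /
      ((nodepoly L)^`().[L j] * (L i - L j))).
  apply: continuous_big => [|j _ w]; first exact: add_continuous.
  have cm := continuousM (cfg f i j w) (cfg g i j w).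
  exact: continuousM cm (@cst_continuous _ _ _ w).
have cw : continuous (fun w : M => set_val w : C) by exact: initial_continuous.
move=> w; under eq_fun do rewrite mxE.
have cfg' := continuousM (@pa_coord_cts f i w) (@pa_coord_cts g i w).
exact: continuousB cfg' (continuousM (cw w) (cS w)).
Qed.
Definition pa_mul f g : T := pa_mk (@pa_mul_subproof f g).

Fact pa_addA : associative pa_add.
Proof. by move=> f g h; apply: pa_ext => w; rewrite !pa_mkE addrA. Qed.
Fact pa_addC : commutative pa_add.
Proof. by move=> f g; apply: pa_ext => w; rewrite !pa_mkE addrC. Qed.
Fact pa_add0 : left_id (pa_cst 0) pa_add.
Proof. by move=> f; apply: pa_ext => w; rewrite !pa_mkE add0r. Qed.
Fact pa_addN : left_inverse (pa_cst 0) pa_opp pa_add.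
Proof. by move=> f; apply: pa_ext => w; rewrite !pa_mkE addNr. Qed.

HB.instance Definition _ :=
  GRing.isZmodule.Build T pa_addA pa_addC pa_add0 pa_addN.

Fact pa_mulA : associative pa_mul.
Proof. by move=> f g h; apply: pa_ext => w; rewrite !pa_mkE polyprodA. Qed.
Fact pa_mulC : commutative pa_mul.
Proof. by move=> f g; apply: pa_ext => w; rewrite !pa_mkE polyprodC. Qed.
Fact pa_mul1 : left_id (pa_cst (const_mx 1)) pa_mul.
Proof. by move=> f; apply: pa_ext => w; rewrite !pa_mkE polyprod1. Qed.
Fact pa_mulDl : left_distributive pa_mul +%R.
Proof. by move=> f g h; apply: pa_ext => w; rewrite !pa_mkE polyprodDl. Qed.
Fact pa_1neq0 : pa_cst (const_mx 1) != 0.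
Proof.
have [w Mw] := cset_neq0 M; apply/eqP => /(congr1 (fun f : T =>
  pa_val f (SigSub (mem_set Mw)) (Ordinal (nodes_gt0 L)) 0)).
by rewrite !pa_mkE !mxE => /eqP; rewrite oner_eq0.
Qed.

HB.instance Definition _ := GRing.Zmodule_isComNzRing.Build T
  pa_mulA pa_mulC pa_mul1 pa_mulDl pa_1neq0.

Fact pa_scaleA (a b : C) f : pa_scale a (pa_scale b f) = pa_scale (a * b) f.
Proof. by apply: pa_ext => w; rewrite !pa_mkE scalerA. Qed.
Fact pa_scale1 : left_id 1 pa_scale.
Proof. by move=> f; apply: pa_ext => w; rewrite !pa_mkE scale1r. Qed.
Fact pa_scaleDr : right_distributive pa_scale +%R.
Proof. by move=> a f g; apply: pa_ext => w; rewrite !pa_mkE scalerDr. Qed.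
Fact pa_scaleDl f : {morph pa_scale^~ f : a b / a + b}.
Proof. by move=> a b; apply: pa_ext => w; rewrite !pa_mkE scalerDl. Qed.

HB.instance Definition _ := GRing.Zmodule_isLmodule.Build C T
  pa_scaleA pa_scale1 pa_scaleDr pa_scaleDl.

Fact pa_scaleAl (a : C) f g : a *: (f * g) = (a *: f) * g.
Proof. by apply: pa_ext => w; rewrite !pa_mkE polyprodZl. Qed.

HB.instance Definition _ := GRing.Lmodule_isLalgebra.Build C T pa_scaleAl.

Fact pa_scaleAr (a : C) f g : a *: (f * g) = f * (a *: g).
Proof. by rewrite mulrC pa_scaleAl mulrC. Qed.

HB.instance Definition _ := GRing.Lalgebra_isAlgebra.Build C T pa_scaleAr.

(** The [j]-th component of [f] as a function on the plane; its value [0] off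
    [M] is a dummy. *)
Definition coordfun f (j : 'I_d) (w : C) : C :=
  'valL_(0 : 'cV[C]_d) (pa_val f) w j 0.

Lemma coordfunE f j w (Mw : w \in (M : set C)) :
  coordfun f j w = pa_val f (SigSub Mw) j 0.
Proof. by rewrite /coordfun /= oinv_set_val insubT. Qed.

(** The scalar function [f^] associated with [f]; meaningful at the points [z]
    such that [p(z)] lies in [M]. *)
Definition hat f (z : C) : C :=
  \sum_(j < d) (lagr L j).[z] * coordfun f j (nodepoly L).[z].

Lemma hatE f z (Mw : (nodepoly L).[z] \in (M : set C)) :
  hat f z = (interp L (pa_val f (SigSub Mw))).[z].
Proof.
rewrite /hat horner_sum; apply: eq_bigr => j _.
by rewrite hornerZ mulrC (coordfunE _ _ Mw).
Qed.

End PolyAlg.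

Section Ideal.
Variables (C : numClosedFieldType) (d : nat) (L : nodes C d) (K : cset C).
Local Notation T := (polyalg L (polyimage (nodepoly L) K)).

Lemma hatD_mul (f g : T) z : cset_set K z -> hat (f + g) z = hat f z + hat g z /\
  hat (f * g) z = hat f z * hat g z.
Proof.
move=> Kz; have Mw : (nodepoly L).[z] \in (polyimage (nodepoly L) K : set C).
  by apply: mem_set; exists z.
rewrite !(hatE _ Mw) !pa_mkE interpD hornerD; split=> //.
have [Q /(_ (nodepoly L).[z])/(congr1 (horner^~ z))] :=
  interp_mul L (pa_val f (SigSub Mw)) (pa_val g (SigSub Mw)).
by rewrite !hornerE subrr mulr0 addr0 => ->.
Qed.

(** The ideal of the [f] in C_Lambda(p(K)) whose [f^] vanishes on [K]. *)
Definition vanish (f : T) : bool := `[< forall z, cset_set K z -> hat f z = 0 >].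

Fact vanish_ideal : idealr_closed vanish.
Proof.
have hat_cst v z : cset_set K z -> hat (pa_cst L _ v : T) z = (interp L v).[z].
  move=> Kz; rewrite hatE//; first by apply: mem_set; exists z.
split.
- apply/asboolP => z Kz; rewrite hat_cst// /interp big1 ?hornerC// => j _.
  by rewrite mxE scale0r.
- have [z Kz] := cset_neq0 K; apply/asboolP => /(_ z Kz)/eqP.
  by rewrite hat_cst// interp1 hornerC oner_eq0.
- move=> a u v /asboolP u0 /asboolP v0; apply/asboolP => z Kz.
  by have [-> _] := hatD_mul (a * u) v Kz; have [_ ->] := hatD_mul a u Kz;
    rewrite u0// v0// mulr0 addr0.
Qed.

HB.instance Definition _ := isIdealr.Build T vanish vanish_ideal.

Definition vanish_idealr : idealr T := vanish.

End Ideal.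
Arguments vanish_idealr {C d} L K.

(** [{ideal_quot I}] only comes with a ring structure; a scalar [a] acts as the
    class of [a *: 1]. *)
Section QuotientAlgebra.
Variables (C : fieldType) (B : comAlgType C) (I : idealr B).
Local Notation Q := {ideal_quot I}.

Definition quot_scale (a : C) (x : Q) : Q := \pi_Q a%:A * x.

Fact quot_scaleA a b x : quot_scale a (quot_scale b x) = quot_scale (a * b) x.
Proof. by rewrite /quot_scale mulrA -rmorphM -scalerAl mul1r scalerA. Qed.
Fact quot_scale1 : left_id 1 quot_scale.
Proof. by move=> x; rewrite /quot_scale scale1r rmorph1 mul1r. Qed.
Fact quot_scaleDr : right_distributive quot_scale +%R.
Proof. by move=> a x y; rewrite /quot_scale mulrDr. Qed.
Fact quot_scaleDl x : {morph quot_scale^~ x : a b / a + b}.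
Proof. by move=> a b; rewrite /quot_scale scalerDl rmorphD mulrDl. Qed.

HB.instance Definition _ := GRing.Zmodule_isLmodule.Build C Q
  quot_scaleA quot_scale1 quot_scaleDr quot_scaleDl.

Fact quot_scaleAl (a : C) (x y : Q) : a *: (x * y) = (a *: x) * y.
Proof. exact: mulrA. Qed.
HB.instance Definition _ := GRing.Lmodule_isLalgebra.Build C Q quot_scaleAl.

Fact quot_scaleAr (a : C) (x y : Q) : a *: (x * y) = x * (a *: y).
Proof. by rewrite mulrC quot_scaleAl mulrC. Qed.
HB.instance Definition _ := GRing.Lalgebra_isAlgebra.Build C Q quot_scaleAr.

End QuotientAlgebra.

Section MxFun.
Variables (C : fieldType) (n : nat).

(** [T f(D) T^-1] for some diagonalization [T D T^-1] of [B] (and a dummy value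
    if [B] is not diagonalizable); by [mxfunE] the choice is immaterial. *)
Definition mxfun (g : C -> C) (B : 'M[C]_n) : 'M[C]_n :=
  let TD := xget (1%:M, 0) [set TD : 'M[C]_n * 'rV[C]_n |
    TD.1 \in unitmx /\ B = TD.1 *m diag_mx TD.2 *m invmx TD.1] in
  TD.1 *m diag_mx (map_mx g TD.2) *m invmx TD.1.

Lemma mxfunE g (T : 'M[C]_n) (D : 'rV[C]_n) : T \in unitmx ->
  mxfun g (T *m diag_mx D *m invmx T) = T *m diag_mx (map_mx g D) *m invmx T.
Proof.
move=> uT; rewrite /mxfun; case: xgetP => [[S E] _ /= [uS TS]|/(_ (T, D))[]//=].
have SD : (invmx T *m S) *m diag_mx E = diag_mx D *m (invmx T *m S).
  have := congr1 (fun X => invmx T *m X *m S) TS.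
  by rewrite /= !mulmxA mulVmx// mul1mx mulmxKV// => <-; rewrite !mulmxA.
have SgD : (invmx T *m S) *m diag_mx (map_mx g E) =
    diag_mx (map_mx g D) *m (invmx T *m S).
  apply/matrixP => i j; move/matrixP/(_ i j): SD.
  rewrite mul_mx_diag mul_diag_mx [LHS]mxE [RHS]mxE => SD.
  rewrite mul_mx_diag mul_diag_mx [LHS]mxE [RHS]mxE ![map_mx _ _ _ _]mxE.
  have [->|x0] := eqVneq ((invmx T *m S) i j) 0; first by rewrite mulr0 mul0r.
  by move: SD; rewrite mulrC => /(mulIf x0) ->; rewrite mulrC.
have := congr1 (fun X => T *m X *m invmx S) SgD.
by rewrite /= !mulmxA mulmxV// mul1mx mulmxK.
Qed.

End MxFun.

(** [f] is only evaluated on [p(sigma(A))]: by spectral mapping this contains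
    the diagonal entries used by [mxfun]. *)
Definition chi (C : numClosedFieldType) (n d : nat) (L : nodes C d)
    (A : 'M[C]_n.+1) (f : polyalg L (polyimage (nodepoly L) (mxspec A))) :
    'M[C]_n.+1 :=
  \sum_(j < d) horner_mx A (lagr L j) *m
               mxfun (coordfun f j) (horner_mx A (nodepoly L)).

(* Main.v *)
Require Import Defs.
From mathcomp Require Import all_boot all_order all_algebra.
From mathcomp Require Import generic_quotient ring_quotient complex.
From mathcomp Require Import boolp classical_sets reals.

Set Implicit Arguments.
Unset Strict Implicit.
Unset Printing Implicit Defensive.

Import GRing.Theory.
Local Open Scope classical_set_scope.
Local Open Scope quotient_scope.
Local Open Scope ring_scope.

(** Both spectra are the set of values of [hat f] on the spectrum of [A].

    On the matrix side, [B = p(A)] is diagonalizable, so applying a scalar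
    function to [B] only involves the values of that function on the finite set
    [p(sigma(A))], where it may be replaced by an interpolating polynomial
    ([mxfun_horner]).  Hence [chi f] is a polynomial [Q] in [A], and [Q] agrees
    with [hat f] on [sigma(A)] ([chi_horner]); spectral mapping for polynomials
    ([eigenvalue_horner]) gives [hat f (sigma(A))].

    On the algebra side, [f |-> hat f z] is a character of [C_Lambda(p(K))] for
    every [z] in [K], and the ideal is the common kernel of these characters.
    So [hat f z] is in the spectrum of the coset of [f].  Conversely, [K] being
    finite, if [mu] is not a value of [hat f] on [K] then some polynomial [q]
    takes the value [1 / (w - mu)] at each value [w] of [hat f], and the coset
    of [q(f)] inverts that of [f - mu] ([spectrum_quotient]).  Being a polynomial
    in [f], this inverse is a continuous function without further argument. *)

Lemma poly_interpolation (F : fieldType) (s : seq F) (g : F -> F) :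
  exists q : {poly F}, {in s, forall x, q.[x] = g x}.
Proof.
elim: s => [|a s [q qE]]; first by exists 0.
have [as_|nas] := boolP (a \in s).
  by exists q => x; rewrite inE => /predU1P[->|]; exact: qE.
pose m := \prod_(z <- s) ('X - z%:P).
have ma0 : m.[a] != 0 by rewrite -rootE root_prod_XsubC.
exists (q + ((g a - q.[a]) / m.[a]) *: m) => x.
rewrite inE hornerD hornerZ => /predU1P[->|xs]; first by rewrite divfK// subrKC.
have /rootP -> : root m x by rewrite root_prod_XsubC.
by rewrite mulr0 addr0 qE.
Qed.

Lemma eigenvalue_seq (C : closedFieldType) n (A : 'M[C]_n) :
  exists s : seq C, eigenvalue A =i s.
Proof.
have [s sE] := closed_field_poly_normal (char_poly A).
exists s => a; rewrite [LHS]eigenvalue_root_char sE rootZ ?root_prod_XsubC//.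
by rewrite lead_coef_eq0 monic_neq0// char_poly_monic.
Qed.

(** Spectral mapping.  If [q - mu] has no zero among the eigenvalues of [A], it
    is coprime to the characteristic polynomial, and by Cayley-Hamilton a Bezout
    relation evaluated at [A] inverts [q(A) - mu]. *)
Lemma eigenvalue_horner (C : closedFieldType) n (A : 'M[C]_n.+1) (q : {poly C})
    (mu : C) :
  eigenvalue (horner_mx A q) mu <-> exists2 z, eigenvalue A z & q.[z] = mu.
Proof.
split=> [|[z /eigenvalueP[v vA v0] <-]]; last first.
  apply/eigenvalueP; exists v => //.
  elim/poly_ind: q => [|q c ih].
    by rewrite rmorph0 mulmx0 horner0 scale0r.
  rewrite rmorphD rmorphM /= horner_mx_X horner_mx_C !hornerE mulmxDr.
  by rewrite mulmxA ih -scalemxAl vA scalerA mul_mx_scalar scalerDl.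
move=> /eigenvalueP[v vq v0]; apply: contrapT => nz.
have /Bezout_eq1_coprimepP[[a b] /= ab1] : coprimep (char_poly A) (q - mu%:P).
  apply: Pdiv.ClosedField.root_coprimep => x rx.
  rewrite !hornerE subr_eq0; apply/eqP => qx; apply: nz; exists x => //.
  by rewrite eigenvalue_root_char.
have : v *m horner_mx A ((q - mu%:P) * b) = 0.
  rewrite rmorphM rmorphB /= horner_mx_C mulmxA mulmxBr vq mul_mx_scalar.
  by rewrite subrr mul0mx.
have -> : (q - mu%:P) * b = 1 - a * char_poly A.
  by rewrite mulrC -ab1 addrAC subrr add0r.
rewrite rmorphB rmorphM /= Cayley_Hamilton mulr0 subr0 rmorph1 mulmx1.
by move/eqP; rewrite (negbTE v0).
Qed.

(** The eigenvector is the [i]-th row of [T^-1], since [T^-1 (T D T^-1) = D T^-1]. *)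
Lemma eigenvalue_similar_diag (F : fieldType) n (T : 'M[F]_n) (D : 'rV[F]_n) i :
  T \in unitmx -> eigenvalue (T *m diag_mx D *m invmx T) (D 0 i).
Proof.
move=> uT; apply/eigenvalueP; exists (row i (invmx T)).
  rewrite -row_mul !mulmxA mulVmx// mul1mx row_mul row_diag_mx.
  by rewrite -scalemxAl -rowE.
apply/negP => /eqP; rewrite rowE => /(congr1 (mulmx^~ T)).
rewrite /= mulmxKV// mul0mx => /rowP/(_ i).
by rewrite !mxE !eqxx => /eqP; rewrite oner_eq0.
Qed.

(** In a basis of eigenvectors both sides are diagonal, and [g] and [q] are only
    applied to diagonal entries, which are eigenvalues of [B]. *)
Lemma mxfun_horner (F : fieldType) n (B : 'M[F]_n.+1) (g : F -> F)
    (q : {poly F}) :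
  diagonalizable B -> (forall w, eigenvalue B w -> q.[w] = g w) ->
  mxfun g B = horner_mx B q.
Proof.
move=> [P uP /(diagonalizable_forLR uP)[D]].
rewrite mxpoly.conjVmx// => BE qg.
have uV : invmx P \in unitmx by rewrite unitmx_inv.
have {1}-> : B = invmx P *m diag_mx D *m invmx (invmx P) by rewrite invmxK.
rewrite mxfunE// BE horner_mx_uconjC// horner_mx_diag invmxK.
congr (_ *m diag_mx _ *m _); apply/rowP => i; rewrite !mxE qg// BE.
by rewrite -[X in _ *m X]invmxK eigenvalue_similar_diag.
Qed.

(** Evaluation of [hat] at a point of [K] is a character: it commutes with the
    polynomial functional calculus of the algebra. *)
Section HatCharacter.
Variables (C : numClosedFieldType) (d : nat) (L : nodes C d) (K : cset C).
Local Notation T := (polyalg L (polyimage (nodepoly L) K)).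
Variables (z : C) (Kz : cset_set K z).
Implicit Types (f g : T).

Let Mz : (nodepoly L).[z] \in (polyimage (nodepoly L) K : set C).
Proof. by apply: mem_set; exists z. Qed.

Lemma hat_alg (c : C) : hat (c%:A : T) z = c.
Proof.
rewrite (hatE _ Mz) (_ : pa_val _ _ = c *: const_mx 1)//.
by rewrite interpZ interp1 hornerZ hornerC mulr1.
Qed.

Lemma hat_sub_alg f (c : C) : hat (f - c%:A) z = hat f z - c.
Proof. by rewrite -scaleNr (hatD_mul _ _ Kz).1 hat_alg. Qed.

Lemma hat_sub1 f : hat (f - 1) z = hat f z - 1.
Proof. by rewrite -[1 in LHS]scale1r hat_sub_alg. Qed.

Lemma hat_horner_alg f (q : {poly C}) : hat (horner_alg f q) z = q.[hat f z].
Proof.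
elim/poly_ind: q => [|q c ih]; first by rewrite rmorph0 horner0 -(scale0r 1) hat_alg.
rewrite rmorphD rmorphM /= horner_algC horner_algX.
by rewrite (hatD_mul _ _ Kz).1 (hatD_mul _ _ Kz).2 ih hat_alg !hornerE.
Qed.

End HatCharacter.

(** For finite [K], interpolation at the values of [hat f] turns pointwise
    invertibility of [hat f - mu] on [K] into invertibility modulo the ideal. *)
Lemma spectrum_quotient (C : numClosedFieldType) d (L : nodes C d) (K : cset C)
    (s : seq C) (Ks : forall z, cset_set K z -> z \in s)
    (f : polyalg L (polyimage (nodepoly L) K)) :
  spectrum (\pi_{ideal_quot vanish_idealr L K} f) =
  [set mu | exists2 z, cset_set K z & hat f z = mu].
Proof.
pose Q : comNzRingType := {ideal_quot vanish_idealr L K}.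
have piE u v : \pi_Q u = \pi_Q v <-> forall z, cset_set K z -> hat (u - v) z = 0.
  split=> [/eqP|uv].
    by rewrite -Quotient.idealrBE => /asboolP.
  by apply/eqP; rewrite -Quotient.idealrBE; apply/asboolP.
have pi_sub mu : \pi_Q f - mu%:A = \pi_Q (f - mu%:A).
  by rewrite rmorphB /= {1}/GRing.scale /= /quot_scale mulr1.
apply/seteqP; split=> mu /=.
  apply: contra_notP => nmu.
  have [q qE] := poly_interpolation (map (hat f) s) (fun w => (w - mu)^-1).
  have inv : \pi_Q (f - mu%:A) * \pi_Q (horner_alg f q) = 1.
    rewrite -rmorphM -(rmorph1 \pi_Q); apply/piE => z Kz.
    rewrite hat_sub1// (hatD_mul _ _ Kz).2 hat_sub_alg//.
    rewrite hat_horner_alg// qE ?map_f ?Ks// mulfV ?subrr// subr_eq0.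
    by apply/eqP => fz; apply: nmu; exists z.
  exists (\pi_Q (horner_alg f q)); rewrite pi_sub; split; first exact: inv.
  by rewrite mulrC; exact: inv.
move=> [z Kz fz] [b [+ _]]; rewrite pi_sub -[b]reprK -rmorphM -(rmorph1 \pi_Q).
move=> /piE/(_ z Kz); rewrite hat_sub1// (hatD_mul _ _ Kz).2.
by rewrite hat_sub_alg// fz subrr mul0r sub0r => /eqP; rewrite oppr_eq0 oner_eq0.
Qed.

(** The interpolating polynomials [q j] replace the components of [f] on
    [p(sigma(A))], so that [Q] is the formula for [hat f] with [q j] in place of
    the [j]-th component. *)
Lemma chi_horner (C : numClosedFieldType) n d (L : nodes C d) (A : 'M[C]_n.+1)
    (f : polyalg L (polyimage (nodepoly L) (mxspec A))) :
  diagonalizable (horner_mx A (nodepoly L)) ->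
  exists2 Q : {poly C}, chi f = horner_mx A Q &
    forall z, eigenvalue A z -> Q.[z] = hat f z.
Proof.
move=> diagB; have [s sE] := eigenvalue_seq A.
have /choice[q qE] j := poly_interpolation
  (map (fun z => (nodepoly L).[z]) s) (coordfun f j).
exists (\sum_(j < d) lagr L j * (q j \Po nodepoly L)) => [|z Az]; last first.
  rewrite horner_sum; apply: eq_bigr => j _.
  by rewrite hornerM horner_comp qE// map_f// -sE.
rewrite rmorph_sum; apply: eq_bigr => j _; rewrite rmorphM /=; congr (_ *m _).
rewrite (mxfun_horner (q := q j))//.
  elim/poly_ind: (q j) => [|r c ih]; first by rewrite comp_poly0 !rmorph0.
  rewrite comp_polyD comp_polyM comp_polyX comp_polyC !rmorphD !rmorphM /=.
  by rewrite ih horner_mx_X !horner_mx_C.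
by move=> w /eigenvalue_horner[z Az <-]; rewrite qE// map_f// -sE.
Qed.

Theorem theorem3p4 (R : realType) (n d : nat) (L : nodes R[i] d)
    (A : 'M[R[i]]_n.+1)
    (diagB : diagonalizable (horner_mx A (nodepoly L)))
    (f : polyalg L (polyimage (nodepoly L) (mxspec A))) :
  [set mu | eigenvalue (chi f) mu] =
  spectrum (\pi_{ideal_quot vanish_idealr L (mxspec A)} f).
Proof.
have [s sE] := eigenvalue_seq A.
rewrite (@spectrum_quotient _ _ _ _ s) => [|z]; last by rewrite -sE.
have [Q -> Qf] := chi_horner f diagB.
apply/seteqP; split=> mu /=.
  by move/eigenvalue_horner=> [z Az <-]; exists z; rewrite ?Qf.
by move=> [z Az <-]; apply/eigenvalue_horner; exists z; rewrite ?Qf.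
Qed.
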